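(* Let $R$ be a ring. Then the following statements are equivalent: (1) $R$ is von Neumann regular; (2) every pure-injective left $R$-module is injective; (3) every semi-compact left $R$-module is injective.
   Context: Rings are associative with identity and modules are unitary. For a left $R$-module $M$ and a left ideal $I$ of $R$, $M[I]=\{m\in M\mid Im=0\}$. $M$ is semi-compact if every set of congruences $x\equiv x_\alpha\pmod{M[I_\alpha]}$ ($\alpha\in\Lambda$, $x_\alpha\in M$, $I_\alpha$ a left ideal of $R$), each finite subset of which has a common solution in $M$, has a simultaneous solution in $M$. A short exact sequence of left modules is pure if every finitely presented left module is projective relative to it; a module is pure-injective if it is injective relative to every pure exact sequence. $R$ is von Neumann regular if for each $a\in R$ there is $b\in R$ with $a=aba$. *)

(* Defs.v *)
From HB Require Import structures.
From mathcomp Require Import all_boot all_order all_algebra.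
From mathcomp Require Import boolp classical_sets functions cardinality.

Set Implicit Arguments.
Unset Strict Implicit.
Unset Printing Implicit Defensive.

Import GRing.Theory.
Local Open Scope classical_set_scope.
Local Open Scope ring_scope.

(* Rings are [pzRingType]s, so that the zero ring is allowed. *)
Definition von_neumann_regular (R : pzRingType) : Prop :=
  forall a : R, exists b : R, a = a * b * a.

Section Modules.
Variable R : pzRingType.
Implicit Types A B C M P : lmodType R.

(* [R^o] is R seen as a left module over itself, where [r *: x] is [r * x]. *)
Definition left_ideal (I : set R) : Prop :=
  submod_closed ([pred x | x \in I] : {pred R^o}).

Definition annihilated M (I : set R) : set M :=
  [set m | forall r, I r -> r *: m = 0].

Arguments annihilated M I : clear implicits.

Definition congr_mod M (N : set M) (x y : M) : Prop := N (x - y).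

Definition semi_compact M : Prop :=
  forall (L : Type) (x : L -> M) (I : L -> set R),
    (forall l, left_ideal (I l)) ->
    (forall F : set L, finite_set F ->
       exists m, forall l, F l -> congr_mod (annihilated M (I l)) m (x l)) ->
    exists m, forall l, congr_mod (annihilated M (I l)) m (x l).

Definition exact_at A B C (f : {linear A -> B}) (g : {linear B -> C}) : Prop :=
  range f = g @^-1` [set 0].

Definition short_exact A B C (f : {linear A -> B}) (g : {linear B -> C}) :
    Prop :=
  [/\ injective f, exact_at f g & range g = setT].

Definition finitely_presented P : Prop :=
  exists (m n : nat) (u : {linear 'rV[R]_m -> 'rV[R]_n})
         (p : {linear 'rV[R]_n -> P}),
    exact_at u p /\ range p = setT.

Definition projective_relative P B C (g : {linear B -> C}) : Prop :=
  forall h : {linear P -> C}, exists k : {linear P -> B}, g \o k =1 h.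

Definition injective_relative M A B (f : {linear A -> B}) : Prop :=
  forall h : {linear A -> M}, exists k : {linear B -> M}, k \o f =1 h.

Definition pure_exact A B C (f : {linear A -> B}) (g : {linear B -> C}) :
    Prop :=
  short_exact f g /\
  forall P, finitely_presented P -> projective_relative P g.

Definition pure_injective M : Prop :=
  forall A B C (f : {linear A -> B}) (g : {linear B -> C}),
    pure_exact f g -> injective_relative M f.

Definition injective_module M : Prop :=
  forall A B (f : {linear A -> B}), injective f -> injective_relative M f.

End Modules.

(* Main.v *)
Require Import Defs.
From mathcomp Require Import all_boot all_order all_algebra.
From HB Require Import structures.
From mathcomp Require Import boolp classical_sets functions cardinality.
From mathcomp Require Import ring_quotient.

Set Implicit Arguments.
Unset Strict Implicit.
Unset Printing Implicit Defensive.

Import GRing.Theory Num.Theory.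
Local Open Scope classical_set_scope.
Local Open Scope ring_scope.

(** If [R] is regular, every finitely generated left ideal is generated by an
    idempotent and, more generally, every matrix [U] over [R] has a
    quasi-inverse [V], that is [U V U = U] ([regular_quasi_inverse]).  Hence
    finitely presented modules are projective: maps out of them lift along
    every surjection ([regular_fp_projective]), so every short exact sequence
    is pure and pure-injective modules are injective.  For a semi-compact
    module [M], Baer's criterion asks, given a linear [f : I -> M], for a single
    [m] with [f r = r m] on [I].  Writing [r = r b r], this is the congruence
    of [m] to [f (b r)] modulo [M[Rr]]; finitely many of these are solved by
    [f e], where [e] is an idempotent of [I] fixed by the finitely many [r]
    involved, and semi-compactness does the rest.

    Conversely, fix [a] in [R] and let [M] be the character module
    [Hom_Z (R/aR, D)] of the right module [R/aR], where [D] is divisible; it is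
    a left module, encoded as the additive maps [R -> D] killing [aR]
    ([dual]).  Divisibility of [D], i.e. its injectivity as an abelian group,
    makes [M] both pure-injective and semi-compact, so each of the two
    hypotheses makes [M] injective.  With [D = Q/Z], if [a] were not in [aRa]
    there would be an additive [psi : R -> D] killing [aRa] but not [a].  Then
    [x a |-> (y |-> psi (y x a))] is a linear map [Ra -> M]; by injectivity it
    is [t |-> t m] for some [m] in [M], whence [psi a = (a m) 1 = m a = 0],
    a contradiction.

    Maps defined on a part of a module are handled throughout as their graphs,
    the additive single-valued relations: the domains that occur are sums such
    as [f(A) + aB], on which a function would need a well-definedness argument
    before it can even be written down. *)

(** * Linear relations and Baer's criterion *)

Section PartialLinear.
Variable R : pzRingType.
Implicit Types A B V M : lmodType R.

Definition submodule V (N : set V) : Prop :=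
  N 0 /\ forall a x y, N x -> N y -> N (a *: x + y).

(** Graphs of linear maps defined on a submodule of [A]; for a submodule,
    single-valuedness need only be tested over [0]. *)
Definition partial_linear A B (G : set (A * B)) : Prop :=
  submodule G /\ forall y, G (0, y) -> y = 0.

Lemma submoduleZ V (N : set V) a x : submodule N -> N x -> N (a *: x).
Proof. by move=> [N0 Nl] Nx; rewrite -[_ *: _]addr0; apply: Nl. Qed.

Lemma submoduleB V (N : set V) x y : submodule N -> N x -> N y -> N (x - y).
Proof. by move=> [N0 Nl] Nx Ny; rewrite addrC -scaleN1r; apply: Nl. Qed.

Lemma linear_map_of A B (f : A -> B) :
  linear f -> exists k : {linear A -> B}, k =1 f.
Proof.
move=> fl; pose m := GRing.isLinear.Build R A B *:%R f fl.
by exists (HB.pack_for {linear A -> B} f m).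
Qed.

Lemma partial_linear_fun A B (G : set (A * B)) x y z :
  partial_linear G -> G (x, y) -> G (x, z) -> y = z.
Proof.
move=> [Gs G0] Gy Gz; apply/eqP; rewrite -subr_eq0; apply/eqP/G0.
by rewrite -(subrr x); apply: (submoduleB Gs Gy Gz).
Qed.

Lemma total_partial_linear A B (G : set (A * B)) :
  partial_linear G -> (forall x, exists y, G (x, y)) ->
  exists k : {linear A -> B}, forall x y, G (x, y) -> k x = y.
Proof.
move=> Gp /choice[f Gf].
have [|k kf] := @linear_map_of A B f.
  move=> a x y; apply: (partial_linear_fun Gp (Gf _)).
  exact: (Gp.1.2 a _ _ (Gf x) (Gf y)).
by exists k => x y; rewrite kf; apply: partial_linear_fun (Gf x).
Qed.

Lemma linear_factor A B M (p : {linear A -> B}) (f : {linear A -> M}) :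
  range p = setT -> (forall x, p x = 0 -> f x = 0) ->
  exists k : {linear B -> M}, k \o p =1 f.
Proof.
move=> ps pf.
have [||k kG] := @total_partial_linear B M [set z | exists x, z = (p x, f x)].
- split=> [|y [x [/esym/pf <- ->]]] //; split.
    by exists 0; rewrite !linear0.
  by move=> a _ _ [x ->] [y ->]; exists (a *: x + y); rewrite !linearP.
- move=> y; have [x _ <-] : range p y by rewrite ps.
  by exists (f x), x.
by exists k => x; apply: kG; exists x.
Qed.

(** The hypothesis of Baer's criterion; [H] is the graph of a linear map from a
    left ideal of [R] to [M]. *)
Definition baer_criterion M : Prop :=
  forall H : set (R^o * M), partial_linear H ->
  exists m : M, forall (r : R) y, H (r, y) -> y = r *: m.

(** Zorn's lemma gives a maximal partial linear map [H] extending [G0].  For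
    any [x], the criterion applied to the partial map [r |-> H (r x)], defined
    on the left ideal of those [r] with [r x] in the domain, yields a value [m]
    that may consistently be given to [x]; by maximality [x] is already in the
    domain. *)
Lemma baer_extension M : baer_criterion M ->
  forall B (G : set (B * M)), partial_linear G ->
  exists k : {linear B -> M}, forall x y, G (x, y) -> k x = y.
Proof.
move=> baer B G0 G0p.
(* Maximising over [X] with [X `|` G0] partial linear, rather than over
   [X] containing [G0], makes the empty chain harmless. *)
have [|G [Gp Gmax]] :=
    @Zorn_bigcup (B * M)%type [set X | partial_linear (X `|` G0)].
  move=> F Fp Ftot.
  have dir p q : (\bigcup_(X in F) X `|` G0) p ->
      (\bigcup_(X in F) X `|` G0) q ->
      exists X, [/\ partial_linear (X `|` G0), X `<=` \bigcup_(X in F) X,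
                 (X `|` G0) p & (X `|` G0) q].
    move=> [[X FX Xp]|Gp] [[Y FY Yq]|Gq].
    - have [XY|YX] := Ftot X Y FX FY.
        exists Y; split; [exact: Fp|by move=> z Yz; exists Y|left|left] => //.
        exact: XY.
      exists X; split; [exact: Fp|by move=> z Xz; exists X|left|left] => //.
      exact: YX.
    - by exists X; split; [exact: Fp|move=> z Xz; exists X|left|right].
    - by exists Y; split; [exact: Fp|move=> z Xz; exists Y|right|left].
    - by exists set0; split; [rewrite set0U|move=> z []|right|right].
  split; first split.
  - by right; exact: G0p.1.1.
  - move=> a p q /dir/[apply] -[X [[[_ Xl] _] XF Xp Xq]].
    by have [/XF|] := Xl a p q Xp Xq; [left|right].
  - move=> y hy; have [X [[_ X0] _ Xy _]] := dir _ _ hy hy.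
    exact: X0.
set H := G `|` G0 in Gp.
have GH : H `<=` G.
  move=> p Hp; apply: contrapT => nGp; apply: (Gmax H); last first.
    by rewrite /= /H -setUA setUid.
  by split; [left|move=> /(_ p Hp)].
have {}Gmax K : partial_linear K -> H `<=` K -> K `<=` H.
  move=> Kp HK; apply: contrapT => nKH; apply: (Gmax K).
    split=> [p Gp'|KG]; first by apply: HK; left.
    by apply: nKH => p /KG; left.
  rewrite /= (_ : K `|` G0 = K) //; apply/seteqP.
  split=> [p [//|G0p']|p]; last by left.
  by apply: HK; right.
have [x|k kH] := total_partial_linear Gp; last first.
  by exists k => x y G0xy; apply: kH; right.
have [[H0 Hl] Hf] := Gp.
have [|m Hm] := baer [set z : R^o * M | H ((z.1 : R) *: x, z.2)].
  split; first split; rewrite /= ?scale0r //.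
  move=> a [r y] [s z] /= Hr Hs; rewrite scalerDl -scalerA.
  exact: (Hl a _ _ Hr Hs).
exists m.
(* The extension of [H] by [x |-> m]. *)
apply: (Gmax [set z : B * M | exists r b y,
  H (b, y) /\ z = (r *: x + b, r *: m + y)]).
- split; first split.
  + by exists 0, 0, 0; rewrite !scale0r !addr0.
  + move=> a _ _ [r [b [y [Hy ->]]]] [s [c [z [Hz ->]]]].
    exists (a * r + s), (a *: b + c), (a *: y + z).
    split; first exact: (Hl a _ _ Hy Hz).
    by congr pair; rewrite /= !scalerDr !scalerDl !scalerA addrACA.
  + move=> y [r [b [z [Hz [/esym rb ->]]]]].
    have {}rb : b = - r *: x.
      by apply/eqP; rewrite scaleNr -addr_eq0 addrC rb.
    have -> : z = - r *: m by apply: Hm; rewrite /= -rb.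
    by rewrite scaleNr subrr.
- by move=> [b y] Hy; exists 0, b, y; rewrite !scale0r !add0r.
- by exists 1, 0, 0; rewrite !scale1r !addr0.
Qed.

Lemma baer_injective M : baer_criterion M -> injective_module M.
Proof.
move=> Mbaer A B f finj h.
have [|k kE] := baer_extension Mbaer (G := [set z | exists x, z = (f x, h x)]).
  split=> [|y [x [fx ->]]].
    split; first by exists 0; rewrite !linear0.
    by move=> a _ _ [x ->] [y ->]; exists (a *: x + y); rewrite !linearP.
  by rewrite [x](finj _ 0) ?linear0.
by exists k => x; apply: kE; exists x.
Qed.

(** The quotient [V / N] as a left module: the quotient of the underlying
    abelian group, with the scaling induced on representatives. *)
Lemma quotient_module V (N : set V) : submodule N ->
  exists (C : lmodType R) (g : {linear V -> C}),
    range g = setT /\ g @^-1` [set 0] = N.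
Proof.
move=> Ns.
pose S : {pred V} := [pred x | x \in N].
have Scl : zmod_closed S.
  split; first by apply/mem_set; exact: Ns.1.
  by move=> x y /set_mem Nx /set_mem Ny; apply/mem_set; exact: submoduleB.
pose I : zmodClosed V :=
  HB.pack (S : V -> bool) (GRing.isZmodClosed.Build V S Scl).
pose Q := Quotient.quot I.
have eqQ x y : \pi_Q%qT x = \pi_Q%qT y <-> N (x - y).
  split=> [/eqP|h]; first by rewrite -Quotient.idealrBE => /set_mem.
  by apply/eqP; rewrite -Quotient.idealrBE; apply/mem_set.
have [sc scE] : exists sc : R -> Q -> Q,
    forall a x, sc a (\pi_Q%qT x) = \pi_Q%qT (a *: x).
  exists (fun a x => \pi_Q%qT (a *: repr x)) => a x.
  apply/eqQ; rewrite -scalerBr; apply: submoduleZ => //.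
  by apply/eqQ; rewrite reprK.
have piD x y : \pi_Q%qT (x + y) = \pi_Q%qT x + \pi_Q%qT y.
  exact: Quotient.pi_add.
have scA a b x : sc a (sc b x) = sc (a * b) x.
  by rewrite -[x]reprK !scE scalerA.
have pi0 : \pi_Q%qT 0 = 0 :> Q.
  by apply: (addIr (\pi_Q%qT 0)); rewrite -piD addr0 add0r.
have sc1 : left_id 1 sc by move=> x; rewrite -[x]reprK scE scale1r.
have scDr : right_distributive sc +%R.
  by move=> a x y; rewrite -[x]reprK -[y]reprK -piD !scE -piD scalerDr.
have scDl x : {morph sc^~ x : a b / a + b}.
  by move=> a b; rewrite -[x]reprK !scE -piD scalerDl.
pose C : lmodType R :=
  HB.pack Q (GRing.Zmodule_isLmodule.Build R Q scA sc1 scDr scDl).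
have [|g gE] := @linear_map_of V C \pi_Q%qT.
  by move=> a x y; rewrite piD -scE.
exists C, g; split; apply/seteqP; split=> // x.
- by move=> _; exists (repr (x : Q)) => //; rewrite gE reprK.
- rewrite /= gE => h; rewrite -[x]subr0; apply/eqQ.
  exact: (etrans h (esym pi0)).
- by move=> Nx; rewrite /= gE -pi0; apply/eqQ; rewrite subr0.
Qed.

(** Injectivity lets maps extend along [u] even when [u] is not injective,
    provided they factor through the image of [u]. *)
Lemma injective_extension M A B (u : {linear A -> B}) (h : {linear A -> M}) :
  injective_module M -> (forall x, u x = 0 -> h x = 0) ->
  exists k : {linear B -> M}, k \o u =1 h.
Proof.
move=> Minj uh.
have [|C [p [ps pker]]] := @quotient_module A (u @^-1` [set 0]).
  split=> [|s x y /= ux uy]; first by rewrite /= linear0.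
  by rewrite /= linearP ux uy scaler0 addr0.
have pu x : p x = 0 -> u x = 0.
  by move=> px; have : (p @^-1` [set 0]) x by []; rewrite pker.
have [f fp] := linear_factor ps pu.
have [|h' h'p] := linear_factor (f := h) ps; first by move=> x /pu/uh.
have [|k kf] := Minj _ _ f _ h'.
  move=> c c'; have [x _ <-] : range p c by rewrite ps.
  have [y _ <-] : range p c' by rewrite ps.
  move=> fxy; apply/eqP; rewrite -subr_eq0 -linearB; apply/eqP.
  suff : (p @^-1` [set 0]) (x - y) by [].
  by rewrite pker /= linearB -[u x]fp -[u y]fp /= fxy subrr.
by exists k => x; rewrite /= -[u x]fp [LHS]kf; apply: h'p.
Qed.

End PartialLinear.

(** * Regular rings *)

Section Regular.
Variable R : pzRingType.
Implicit Types A B C M P : lmodType R.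

(** Von Neumann's trick: quasi-inverses need only be found up to a defect
    [U - U Y U] which itself has a quasi-inverse. *)
Lemma quasi_inverse_step m n (U : 'M[R]_(m, n)) (Y Z : 'M[R]_(n, m)) :
  let D := U - U *m Y *m U in
  D *m Z *m D = D -> exists V : 'M[R]_(n, m), U *m V *m U = U.
Proof.
move=> D DZD.
have DE : D = U *m (1%:M - Y *m U) by rewrite mulmxBr mulmx1 mulmxA.
have DE' : D = (1%:M - U *m Y) *m U by rewrite mulmxBl mul1mx.
exists (Y + (1%:M - Y *m U) *m Z *m (1%:M - U *m Y)).
have UZU : U *m ((1%:M - Y *m U) *m Z *m (1%:M - U *m Y)) *m U = D.
  by rewrite -[RHS]DZD {1}DE DE' !mulmxA.
move: UZU; set X := _ *m (_ - _) => UXU.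
by rewrite mulmxDr mulmxDl UXU addrC subrK.
Qed.

Hypothesis Rreg : von_neumann_regular R.

(** Induction on the number of columns for a single row, then on the number
    of rows: a quasi-inverse of the first block, padded with zeros, kills that
    block in the defect [U - U Y U] and leaves a smaller matrix. *)
Lemma regular_quasi_inverse m n (U : 'M[R]_(m, n)) :
  exists V : 'M[R]_(n, m), U *m V *m U = U.
Proof.
have row k (W : 'M[R]_(1, k)) : exists V : 'M[R]_(k, 1), W *m V *m W = W.
  elim: k W => [|k IHk] W.
    by exists 0; apply/matrixP=> i [].
  rewrite -[W](@hsubmxK _ 1 1 k); set b := rsubmx _.
  rewrite [lsubmx _]mx11_scalar; move: (_ 0 0) => a.
  have [a' aa'] := Rreg a; have [b' bb'] := IHk (b - (a * a')%:M *m b).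
  apply: (@quasi_inverse_step _ _ _ (col_mx (a'%:M) 0) (col_mx 0 b')).
  rewrite mul_row_col mulmx0 addr0 -scalar_mxM mul_mx_row -scalar_mxM -aa'.
  by rewrite opp_row_mx add_row_mx subrr mul_row_col mul0mx add0r
    mul_mx_row mulmx0 bb'.
elim: m U => [|m IHm] U.
  by exists 0; apply/matrixP=> -[].
rewrite -[U](@vsubmxK _ 1 m n); set a := usubmx _; set b := dsubmx _.
have [a' aa'] := row _ a; have [b' bb'] := IHm (b - b *m a' *m a).
apply: (@quasi_inverse_step _ _ _ (row_mx a' 0) (row_mx 0 b')).
have -> : col_mx a b - col_mx a b *m row_mx a' 0 *m col_mx a b =
    col_mx 0 (b - b *m a' *m a).
  rewrite -mulmxA mul_row_col mul0mx addr0 mul_col_mx !mulmxA aa'.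
  by rewrite opp_col_mx add_col_mx subrr.
by rewrite -mulmxA mul_row_col mul0mx add0r mul_col_mx mul0mx !mulmxA bb'.
Qed.

(** For a presentation [u], [p] of [P] and a quasi-inverse [V] of [u], the map
    [x |-> x - u (x V)] induces a section of [p], since it kills the image of
    [u] and is the identity modulo that image. *)
Lemma regular_fp_projective P B C (g : {linear B -> C}) :
  finitely_presented P -> range g = setT -> projective_relative P g.
Proof.
move=> [m [n [u [p [up ps]]]]] gs h.
have [V UVU] := regular_quasi_inverse (lin1_mx u).
have /choice[b gb] : forall i : 'I_n, exists b, g b = h (p (delta_mx 0 i)).
  move=> i; have : range g (h (p (delta_mx 0 i))) by rewrite gs.
  by case=> b _ <-; exists b.
(* [k0] lifts [h \o p] on the free module. *)
have [|k0 k0E] := @linear_map_of _ 'rV[R]_n B (fun x => \sum_i x 0 i *: b i).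
  move=> a x y; rewrite scaler_sumr -big_split; apply: eq_bigr => i _ /=.
  by rewrite !mxE scalerDl scalerA.
have gk0 x : g (k0 x) = h (p x).
  rewrite k0E [in RHS](row_sum_delta x) !linear_sum; apply: eq_bigr => i _ /=.
  by rewrite !linearZ /= gb.
have pu y : p (u y) = 0.
  by have : (p @^-1` [set 0]) (u y) by rewrite -up; exists y.
pose e (x : 'rV[R]_n) := x - u (x *m V).
have [|k1 k1E] := @linear_map_of _ 'rV[R]_n B (k0 \o e).
  move=> a x y; rewrite /= /e mulmxDl -scalemxAl [u _]linearP opprD addrACA.
  by rewrite -scalerBr linearP.
have [x px|k kp] := linear_factor (f := k1) ps.
  have [y _ <-] : range u x by rewrite up.
  by rewrite k1E /= /e -!(mul_rV_lin1 u) -!mulmxA (mulmxA (lin1_mx u)) UVU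
    subrr linear0.
exists k => z; have [x _ <-] : range p z by rewrite ps.
by rewrite /= [k (p x)]kp k1E /= gk0 /e linearB pu subr0.
Qed.

Lemma regular_pure_exact A B C (f : {linear A -> B}) (g : {linear B -> C}) :
  short_exact f g -> pure_exact f g.
Proof.
by move=> fg; split=> // P Pfp; apply: regular_fp_projective => //; case: fg.
Qed.

Lemma regular_pure_injective M : pure_injective M -> injective_module M.
Proof.
move=> Minj A B f finj.
have [|C [g [gs gker]]] := @quotient_module R B (range f).
  split; first by exists 0; rewrite ?linear0.
  by move=> a _ _ [x _ <-] [y _ <-]; exists (a *: x + y); rewrite ?linearP.
apply: (Minj _ _ _ f g); apply: regular_pure_exact.
by split=> //; rewrite /exact_at gker.
Qed.

(** If [v] is a quasi-inverse of the column [r], then the entry of [v r] is the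
    element sought. *)
Lemma regular_fg_left_ideal (I : set R) n (r : 'I_n -> R) :
  left_ideal I -> (forall i, I (r i)) ->
  exists2 e, I e & forall i, r i * e = r i.
Proof.
move=> [/set_mem I0 Il] Ir.
have [v rvr] := regular_quasi_inverse (\col_i r i).
exists (\sum_i v 0 i * r i).
  elim/big_ind: _ => // [x y Ix Iy|i _].
    by rewrite -[x]mul1r; apply/set_mem/(Il 1); apply/mem_set.
  rewrite -[_ * _]addr0; apply/set_mem/(Il (v 0 i)); exact/mem_set.
move=> i; move/matrixP/(_ i 0): rvr.
rewrite -mulmxA !mxE big_ord1 !mxE => {2}<-.
by congr (_ * _); apply: eq_bigr => j _; rewrite mxE.
Qed.

(** The unknown [m] of Baer's criterion is subject to one congruence for
    each element [(r, y)] of the graph, namely modulo [M[Rr]]. *)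
Lemma regular_semi_compact M : semi_compact M -> injective_module M.
Proof.
move=> Msc; apply: baer_injective => H Hp; have [Hs _] := Hp.
pose I : set R := [set r | exists y, H (r, y)].
have Iideal : left_ideal I.
  split; first by apply/mem_set; exists 0; exact: Hs.1.
  move=> a x y /set_mem[z Hz] /set_mem[t Ht]; apply/mem_set.
  by exists (a *: z + t); apply: (Hs.2 a _ _ Hz Ht).
have [b rbr] := choice Rreg.
have HZ (s r : R) (y : M) : H (r, y) -> H (s * r, s *: y).
  exact: (submoduleZ s Hs).
pose L := {z : R * M | z \in H}.
have LH (l : L) : H ((sval l).1, (sval l).2) by case: l => -[r y] /= /set_mem.
(* Since [r = r * b r * r], linearity gives [r *: (b r *: y) = y]. *)
pose x (l : L) : M := b (sval l).1 *: (sval l).2.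
have xE (l : L) : (sval l).1 *: x l = (sval l).2.
  rewrite /x scalerA; apply: (partial_linear_fun Hp _ (LH l)).
  by rewrite {1}[(sval l).1]rbr; apply: HZ.
pose J (l : L) : set R := [set s | exists t, s = t * (sval l).1].
have [l|F /finite_seqP[s Fs]|m mE] := Msc L x J.
- split; first by apply/mem_set; exists 0; rewrite mul0r.
  move=> a _ _ /set_mem[s ->] /set_mem[t ->]; apply/mem_set.
  by exists (a * s + t); rewrite mulrDl -mulrA.
- have [i|e [y Hy] re] := regular_fg_left_ideal
      (r := fun i => (sval (tnth (in_tuple s) i)).1) Iideal.
    by exists (sval (tnth (in_tuple s) i)).2.
  (* The value at [e] solves these congruences because [r e = r]. *)
  exists y => l; rewrite Fs /= => /seq_tnthP[i li] _ [t ->].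
  rewrite -scalerA scalerBr xE li; move: (re i) => {}re.
  suff -> : (sval (tnth (in_tuple s) i)).1 *: y =
      (sval (tnth (in_tuple s) i)).2.
    by rewrite subrr scaler0.
  have := HZ (sval (tnth (in_tuple s) i)).1 _ _ Hy; rewrite re => Hi.
  by apply: (partial_linear_fun Hp Hi).
- exists m => r y Hy; pose l : L := exist _ (r, y) (mem_set Hy).
  have /eqP : r *: (m - x l) = 0 by apply: mE; exists 1; rewrite mul1r.
  by rewrite scalerBr subr_eq0 (xE l) => /eqP.
Qed.

End Regular.

(** * Divisible groups and the rationals modulo the integers *)

Definition divisible (D : zmodType) : Prop :=
  forall (d : D) n, (0 < n)%N -> exists e : D, e *+ n = d.

Lemma int_submodule (V : lmodType int) (N : set V) :
  N 0 -> (forall x y, N x -> N y -> N (x - y)) -> submodule N.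
Proof.
move=> N0 NB.
have NN x : N x -> N (- x) by move=> /(NB _ _ N0); rewrite sub0r.
have ND x y : N x -> N y -> N (x + y).
  by move=> Nx /NN Ny; rewrite -[y]opprK; apply: NB.
have Nn x n : N x -> N (x *+ n).
  by move=> Nx; elim: n => [|n IHn]; rewrite ?mulr0n // mulrS; apply: ND.
split=> // a x y Nx Ny; apply: ND => //; rewrite -[a]intz scaler_int.
by case: a => n; [apply: Nn|rewrite NegzE mulrNz; apply/NN/Nn].
Qed.

Lemma int_ideal_principal (K : set int) :
  K 0 -> (forall i j, K i -> K j -> K (i - j)) ->
  exists n : nat, forall k, K k <-> (n %| k)%Z.
Proof.
move=> K0 KB; have [_ Kl] := @int_submodule int^o K K0 KB.
have KM q n : K n -> K (q * n).
  by move=> Kn; rewrite -[_ * _]addr0; apply: (Kl q n 0).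
have [[n nP]|noK] := pselect (exists n : nat, (0 < n)%N /\ K n); last first.
  exists 0%N => k; rewrite dvd0z; split=> [Kk|/eqP-> //].
  apply: contrapT => /negP k0; case: noK; exists `|k|%N.
  by split; rewrite ?absz_gt0 // abszEsg; apply: KM.
pose P k := `[< (0 < k)%N /\ K k%:Z >].
have exP : exists k, P k by exists n; apply/asboolP.
case: (ex_minnP exP) => {n nP exP} n /asboolP[n_gt0 Kn] nmin.
exists n => k; split=> [Kk|/dvdzP[q ->]]; last exact: KM.
have Kmod : K (k %% n)%Z by apply: KB => //; apply: KM.
have mod_ge0 : (0 <= k %% n)%Z by rewrite modz_ge0 // -lt0n.
apply/dvdz_mod0P/eqP; rewrite -absz_eq0 -leqn0 leqNgt; apply/negP => mod_gt0.
have /nmin : P `|(k %% n)%Z|%N by apply/asboolP; rewrite gez0_abs.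
by rewrite leqNgt -ltz_nat gez0_abs // ltz_pmod.
Qed.

(** A partial linear map out of [Z] is defined on some [nZ], with value [d] at
    [n]; divisibility provides the [e] with [n e = d]. *)
Lemma divisible_baer (D : zmodType) :
  divisible D -> @baer_criterion int (zmodule D).
Proof.
move=> Ddiv H Hp; have [Hs H0] := Hp.
have [||n nE] := @int_ideal_principal [set r | exists d, H (r, d)].
- by exists 0; exact: Hs.1.
- by move=> i j [d Hd] [e He]; exists (d - e); exact: (submoduleB Hs Hd He).
have [d Hd] : exists d, H (n%:Z, d) by apply/nE.
have [e en] : exists e : D, e *+ n = d.
  case: (posnP n) Hd => [-> /H0 ->|n_gt0 _]; first by exists 0.
  exact: Ddiv.
exists e => r y Hr; have /dvdzP[q rE] : (n %| r)%Z by apply/nE; exists y.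
have ne : n%:Z *: (e : zmodule D) = d by exact: en.
apply: (partial_linear_fun Hp Hr); rewrite rE -scalerA ne.
exact: (submoduleZ q Hs Hd).
Qed.

Lemma divisible_extension (D V : zmodType) (G : set (V * D)) : divisible D ->
  G (0, 0) -> (forall p q, G p -> G q -> G (p - q)) ->
  (forall d, G (0, d) -> d = 0) ->
  exists psi : {additive V -> D}, forall x d, G (x, d) -> psi x = d.
Proof.
move=> Ddiv G0 GB Gf.
have [|psi psiE] := @baer_extension int (zmodule D) (divisible_baer Ddiv)
  (zmodule V) G.
  by split=> //; apply: int_submodule.
have psiB : zmod_morphism (psi : V -> D) by move=> x y; exact: linearB.
by exists (HB.pack_for {additive V -> D} (psi : V -> D)
  (GRing.isZmodMorphism.Build V D psi psiB)).
Qed.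

(** [D] is [Q/Z], and the element of order [n] is the class of [1/n]. *)
Lemma rationals_mod_integers : exists D : zmodType, divisible D /\
  forall n, (0 < n)%N ->
    exists d : D, forall k : int, d *~ k = 0 <-> (n %| k)%Z.
Proof.
have [|D [g [gs gker]]] :=
    @quotient_module int (zmodule rat) [set x | (x : rat) \is a Num.int].
  by apply: int_submodule => [|x y]; [exact: rpred0|exact: rpredB].
have n0 n : (0 < n)%N -> n%:R != 0 :> rat by rewrite pnatr_eq0 -lt0n.
exists D; split=> [d n n_gt0|n n_gt0].
  have [q _ <-] : range g d by rewrite gs.
  exists (g (q / n%:R : rat)); rewrite -raddfMn; congr (g _).
  by rewrite -mulrnAl -[in LHS]mulr_natr mulfK // n0.
exists (g (n%:R^-1 : rat)) => k.
have -> : g (n%:R^-1 : rat) *~ k = g (k%:~R / n%:R : rat).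
  by rewrite -raddfMz -mulrzl.
have -> : g (k%:~R / n%:R : rat) = 0 <-> (k%:~R / n%:R : rat) \is a Num.int.
  by rewrite -[X in _ <-> X]/([set x | (x : rat) \is a Num.int] _) -gker.
split=> [/intrP[m km]|/dvdzP[m ->]].
  apply/dvdzP; exists m; apply: (@intr_inj rat).
  by rewrite intrM -km divfK // n0.
by rewrite intrM mulfK ?n0 // intr_int.
Qed.

(** The cyclic group generated by [v] modulo [N] has order [n0 <> 1] (with
    [0] for infinite order); send [v] to an element of order [n0], or of order
    [2] when [n0 = 0], and extend by divisibility. *)
Lemma additive_separation (D V : zmodType) (N : set V) (v : V) :
  divisible D ->
  (forall n, (0 < n)%N ->
    exists d : D, forall k : int, d *~ k = 0 <-> (n %| k)%Z) ->
  N 0 -> (forall x y, N x -> N y -> N (x - y)) -> ~ N v ->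
  exists psi : {additive V -> D}, (forall x, N x -> psi x = 0) /\ psi v <> 0.
Proof.
move=> Ddiv Dtor N0 NB Nv.
have NN x : N x -> N (- x) by move=> /(NB _ _ N0); rewrite sub0r.
have [||n0 n0E] := @int_ideal_principal [set k | N (v *~ k)].
- by [].
- by move=> i j Ni Nj; rewrite /= mulrzBr; apply: NB.
have [n [n_gt1 nN]] : exists n : nat, (1 < n)%N /\
    forall k : int, N (v *~ k) -> (n %| k)%Z.
  case: n0 n0E => [|[|n]] nE.
  - by exists 2%N; split=> // k /nE; rewrite dvd0z => /eqP ->.
  - by case: Nv; apply/(nE 1); rewrite dvdz1.
  - by exists n.+2; split=> // k /nE.
have [d dE] := Dtor n (ltnW n_gt1).
have [||e [k [x [Nx [/esym/eqP + ->]]]]|psi psiE] := @divisible_extension D V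
    [set w | exists (k : int) x, N x /\ w = (v *~ k + x, d *~ k)] Ddiv.
- by exists 0, 0; rewrite !mulr0z addr0.
- move=> _ _ [k [x [Nx ->]]] [l [y [Ny ->]]]; exists (k - l), (x - y).
  split; first exact: NB.
  by congr pair; rewrite /= !mulrzBr // opprD addrACA.
- by rewrite addr_eq0 => /eqP vk; apply/dE/nN; rewrite vk; apply: NN.
exists psi; split=> [x Nx|].
  by apply: psiE; exists 0, x; rewrite !mulr0z add0r.
have -> : psi v = d *~ 1 by apply: psiE; exists 1, 0; rewrite addr0.
by move=> /dE; rewrite dvdz1 /= => /eqP n1; rewrite n1 in n_gt1.
Qed.

(** * Character modules of cyclic right modules *)

Section Dual.
Variables (R : pzRingType) (D : zmodType) (a : R).

(** Additive maps on the right module [R/aR], seen on [R]. *)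
Definition dual_functional (phi : R -> D) : Prop :=
  (forall x y, phi (x - y) = phi x - phi y) /\ (forall x, phi (a * x) = 0).

Definition dual_pred : {pred R -> D} := [pred phi | `[< dual_functional phi >]].

Lemma dual_pred_closed : zmod_closed dual_pred.
Proof.
split=> [|p q /asboolP[pB pa] /asboolP[qB qa]]; apply/asboolP; split=> *.
- by rewrite subrr.
- by [].
- by rewrite !fctE pB qB !opprD addrACA.
- by rewrite !fctE pa qa subrr.
Qed.

HB.instance Definition _ :=
  GRing.isZmodClosed.Build (R -> D) dual_pred dual_pred_closed.

Record dual := Dual { dual_fun :> R -> D; _ : dual_fun \in dual_pred }.

HB.instance Definition _ := [isSub for dual_fun].
HB.instance Definition _ := [Choice of dual by <:].
HB.instance Definition _ := [SubChoice_isSubZmodule of dual by <:].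

Lemma dualP (phi : dual) : dual_functional phi.
Proof. by have /asboolP := valP phi. Qed.

Lemma dual0 (m : dual) : m 0 = 0.
Proof. by have [/(_ 0 0)] := dualP m; rewrite !subrr. Qed.

Lemma dual_gen (m : dual) : m a = 0.
Proof. by have [_ /(_ 1)] := dualP m; rewrite mulr1. Qed.

Lemma dual_ext (p q : dual) : p =1 q -> p = q.
Proof. by move=> pq; apply/val_inj/funext. Qed.

Lemma dual_of (phi : R -> D) : dual_functional phi -> exists m : dual, m =1 phi.
Proof. by move=> /asboolP phiP; exists (Dual phiP). Qed.

Fact dual_scale_subproof s (m : dual) : (fun x => m (x * s)) \in dual_pred.
Proof.
have [mB ma] := dualP m.
by apply/asboolP; split=> *; rewrite ?mulrBl -?mulrA ?mB ?ma.
Qed.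

Definition dual_scale s (m : dual) : dual := Dual (dual_scale_subproof s m).

Fact dual_scaleA s t m : dual_scale s (dual_scale t m) = dual_scale (s * t) m.
Proof. by apply: dual_ext => x /=; rewrite mulrA. Qed.

Fact dual_scale1 : left_id 1 dual_scale.
Proof. by move=> m; apply: dual_ext => x /=; rewrite mulr1. Qed.

Fact dual_scaleDr : right_distributive dual_scale +%R.
Proof. by move=> s m n; apply: dual_ext. Qed.

Fact dual_scaleDl m : {morph dual_scale^~ m : s t / s + t}.
Proof.
have mB := (dualP m).1.
move=> s t; apply: dual_ext => x /=; rewrite mulrDr.
have mN y : m (- y) = - m y.
  by rewrite -[- y]sub0r mB dual0 sub0r.
by rewrite -[X in _ + X]opprK mB mN opprK.
Qed.

HB.instance Definition _ := GRing.Zmodule_isLmodule.Build R dual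
  dual_scaleA dual_scale1 dual_scaleDr dual_scaleDl.

Lemma dual_scaleE s (m : dual) x : (s *: m) x = m (x * s).
Proof. by []. Qed.

Lemma dual_addE (m n : dual) x : (m + n) x = m x + n x.
Proof. by []. Qed.

Lemma dual_oppE (m : dual) x : (- m) x = - m x.
Proof. by []. Qed.

End Dual.

Section CharacterModules.
Variable R : pzRingType.

(** Purity tested against the finitely presented module [R/Ra]: a solution of
    [a z = f x] maps to an element [g z] killed by [a], i.e. to a map
    [R/Ra -> C].  A lift of this map to [B] is an element [z'] killed by [a]
    with [g z' = g z], so that [z - z'] is a solution coming from [A]. *)
Lemma pure_divides (A B C : lmodType R) (f : {linear A -> B})
    (g : {linear B -> C}) (a : R) x z :
  pure_exact f g -> f x = a *: z -> exists x', x = a *: x'.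
Proof.
move=> [[finj fg gs] pure] fxz.
have [|u uE] := @linear_map_of _ 'rV[R]_1 'rV[R]_1 (fun v => v *m a%:M).
  by move=> s v w; rewrite mulmxDl -scalemxAl.
have [|P [p [ps pker]]] := @quotient_module _ _ (range u).
  split; first by exists 0; rewrite ?linear0.
  by move=> s _ _ [v _ <-] [w _ <-]; exists (s *: v + w); rewrite ?linearP.
have [|ev evE] := @linear_map_of _ 'rV[R]_1 C (fun v => v 0 0 *: g z).
  by move=> s v w; rewrite !mxE scalerDl scalerA.
have gf y : g (f y) = 0.
  by have : (g @^-1` [set 0]) (f y) by rewrite -fg; exists y.
have u1 : u 1%:M = a *: 1%:M by rewrite uE mul1mx scalemx1.
have [v pv|h hp] := linear_factor (f := ev) ps.
  have [w _ <-] : range u v by rewrite -pker.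
  by rewrite evE uE !mxE big_ord1 !mxE mulr1n -scalerA -linearZ -fxz gf scaler0.
have [|k kh] := pure P _ h.
  by exists 1%N, 1%N, u, p; rewrite /exact_at pker.
pose z' := k (p 1%:M).
have gz' : g z' = g z by rewrite [LHS]kh [LHS]hp evE mxE scale1r.
have az' : a *: z' = 0.
  rewrite -!linearZ /= -u1; suff -> : p (u 1%:M) = 0 by rewrite linear0.
  by have : (p @^-1` [set 0]) (u 1%:M) by rewrite pker; exists 1%:M.
have [x' _ fx'] : range f (z - z') by rewrite fg /= linearB gz' subrr.
exists x'; apply: finj; rewrite linearZ /= fx' scalerBr az' subr0; exact: fxz.
Qed.

(** Evaluation at [1] identifies linear maps [A -> Hom_Z (R/aR, D)] with
    additive maps [A/aA -> D].  Purity makes [A/aA -> B/aB] injective, and [D]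
    is injective as an abelian group. *)
Lemma dual_pure_injective (D : zmodType) (a : R) :
  divisible D -> pure_injective (dual D a).
Proof.
move=> Ddiv A B C f g fg h.
have [||d [x [z [/esym/eqP + ->]]]|psi psiE] := @divisible_extension D B
    [set w | exists x z, w = (f x + a *: z, h x 1)] Ddiv.
- by exists 0, 0; rewrite !linear0 scaler0 addr0.
- move=> _ _ [x [z ->]] [y [t ->]]; exists (x - y), (z - t).
  congr pair; last by rewrite /= linearB.
  by rewrite /= linearB scalerBr opprD addrACA.
- rewrite addrC addr_eq0 -linearN => /eqP/esym fx.
  have [x' x'E] := pure_divides fg fx.
  have -> : h x = - (a *: h x') by rewrite -linearZ -x'E linearN opprK.
  rewrite dual_oppE dual_scaleE mul1r.
  by rewrite dual_gen oppr0.
have /choice[k kE] (y : B) : exists m : dual D a, m =1 (fun r => psi (r *: y)).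
  apply: dual_of; split=> r; first by move=> s; rewrite scalerBl raddfB.
  rewrite -scalerA; apply: psiE; exists 0, (r *: y).
  by rewrite !linear0 add0r.
have [|k' k'E] := @linear_map_of _ B (dual D a) k.
  move=> s x y; apply: dual_ext => r.
  by rewrite dual_addE dual_scaleE !kE scalerDr scalerA raddfD.
exists k' => x; rewrite /= k'E; apply: dual_ext => r.
rewrite kE -linearZ; apply: psiE; exists (r *: x), 0.
have -> : h (r *: x) = r *: h x by exact: linearZ.
by rewrite scaler0 addr0 dual_scaleE mul1r.
Qed.

(** An element [m] of the module is congruent to [x l] modulo the annihilator
    of [J l] exactly when [m] and [x l] agree on the left ideal [J l].  The
    partial map to be extended is therefore prescribed by its finite
    subsystems: [(r, d)] is in the graph when [m r = d] for all solutions [m]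
    of some finite subsystem.  Consistency of finite subsystems makes this
    single-valued. *)
Lemma dual_semi_compact (D : zmodType) (a : R) :
  divisible D -> semi_compact (dual D a).
Proof.
move=> Ddiv L x J Jideal Jfin.
pose solves (F : set L) (m : dual D a) :=
  forall l, F l -> congr_mod (annihilated (J l)) m (x l).
have [||d [F [Ffin Fd]]|psi psiE] := @divisible_extension D R
    [set w | exists F, finite_set F /\
      forall m, solves F m -> m w.1 = w.2] Ddiv.
- by exists set0; split=> // m _; rewrite /= dual0.
- move=> v w [F [Ffin Fv]] [E [Efin Ew]]; exists (F `|` E).
  split=> [|m ms]; first by rewrite finite_setU.
  by rewrite /= (dualP m).1 Fv ?Ew // => l Fl; apply: ms; [right|left].
- have [m ms] := Jfin _ Ffin; have /= <- := Fd m ms.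
  exact: dual0.
have [|m mE] := @dual_of R D a psi.
  split=> y; first by move=> z; rewrite raddfB.
  (* Every element of the module kills [a * y], so no congruence is needed. *)
  by apply: psiE; exists set0; split=> // m _; rewrite /= (dualP m).2.
exists m => l r Jr; apply: dual_ext => y.
have Jyr : J l (y * r).
  have [J0 JD] := Jideal l; rewrite -[y * r]addr0.
  by apply/set_mem/(JD y r 0) => //; apply/mem_set.
rewrite dual_scaleE dual_addE dual_oppE mE.
apply/eqP; rewrite subr_eq0; apply/eqP/psiE; exists [set l].
(* The subsystem consisting of [l] alone forces the value at [y * r]. *)
split=> [|n /(_ l erefl (y * r) Jyr) nl]; first exact: finite_set1.
have /eqP := congr1 (fun t : dual D a => t 1) nl.
by rewrite dual_scaleE mul1r dual_addE dual_oppE subr_eq0 => /eqP.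
Qed.

(** The map to be extended lives on the left ideal [Ra], the image of the
    endomorphism [x |-> x a] of [R]; it is given by its composite with this
    endomorphism, which vanishes where [x a = 0]. *)
Lemma injective_dual_regular :
  (forall (D : zmodType) (a : R), divisible D -> injective_module (dual D a)) ->
  von_neumann_regular R.
Proof.
move=> dinj a; apply: contrapT => na.
have [D [Ddiv Dtor]] := rationals_mod_integers.
have [||h|psi [psi0 psia]] := additive_separation
    (N := [set x | exists b, x = a * b * a]) (v := a) Ddiv Dtor.
- by exists 0; rewrite mulr0 mul0r.
- by move=> _ _ [b ->] [c ->]; exists (b - c); rewrite mulrBr mulrBl.
- by case: h => b ab; apply: na; exists b.
have kill b : psi (a * b * a) = 0 by apply: psi0; exists b.
have h0P (x : R) : dual_functional a (fun y => psi (y * x * a)).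
  split=> y; first by move=> z; rewrite !mulrBl raddfB.
  by rewrite -(mulrA a) kill.
have /choice[h0 h0E] (x : R) : exists m : dual D a,
    m =1 fun y => psi (y * x * a).
  exact: dual_of.
have [|h hE] := @linear_map_of R R^o (dual D a) h0.
  move=> s x y; apply: dual_ext => r.
  by rewrite dual_addE dual_scaleE !h0E mulrDr mulrDl raddfD mulrA.
have [|u uE] := @linear_map_of R R^o R^o (fun x => x * a).
  by move=> s x y; rewrite mulrDl -[in LHS]mulrA.
have [x ux|k ku] := injective_extension (u := u) (h := h) (dinj D a Ddiv).
  rewrite hE; apply: dual_ext => r.
  by rewrite h0E -mulrA -uE ux mulr0 raddf0.
apply: psia; have := congr1 (fun m : dual D a => m 1) (ku 1).
rewrite /= hE h0E !mul1r => <-.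
have -> : u 1 = a *: (1 : R^o) by rewrite uE mul1r; apply/esym/mulr1.
have -> : k (a *: (1 : R^o)) = a *: k 1 by exact: linearZ.
by rewrite dual_scaleE mul1r dual_gen.
Qed.

End CharacterModules.

Theorem theorem1p3 (R : pzRingType) :
  (von_neumann_regular R <->
   (forall M : lmodType R, pure_injective M -> injective_module M)) /\
  (von_neumann_regular R <->
   (forall M : lmodType R, semi_compact M -> injective_module M)).
Proof.
split; split=> [Rreg M|inj].
- exact: regular_pure_injective.
- apply: injective_dual_regular => D a Ddiv.
  exact/inj/dual_pure_injective.
- exact: regular_semi_compact.
- apply: injective_dual_regular => D a Ddiv.
  exact/inj/dual_semi_compact.
Qed.
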